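(* For all $n\ge2$, all $P,Q\in\Gamma_n$ and all $s\in(-\infty,\infty)$, $$\mathcal V_s(P\Vert Q)\ge4\,\mathcal W_s(P\Vert Q).$$
   Context: $\Gamma_n=\{P=(p_1,\dots,p_n): p_i>0,\ \sum_{i=1}^n p_i=1\}$. For $P,Q\in\Gamma_n$ and $s\in\mathbb{R}$, $$\mathcal V_s(P\Vert Q)=\begin{cases}[s(s-1)]^{-1}\left[\sum_{i=1}^n\left(p_i^sq_i^{1-s}+p_i^{1-s}q_i^s\right)-2\right], & s\ne0,1,\\ \sum_{i=1}^n(p_i-q_i)\ln\left(\frac{p_i}{q_i}\right), & s=0,1,\end{cases}$$ $$\mathcal W_s(P\Vert Q)=\begin{cases}[s(s-1)]^{-1}\left[\sum_{i=1}^n\left(\frac{p_i^{1-s}+q_i^{1-s}}{2}\right)\left(\frac{p_i+q_i}{2}\right)^s-1\right], & s\ne0,1,\\ \frac12\left[\sum_{i=1}^n p_i\ln\left(\frac{2p_i}{p_i+q_i}\right)+\sum_{i=1}^n q_i\ln\left(\frac{2q_i}{p_i+q_i}\right)\right], & s=0,\\ \sum_{i=1}^n\left(\frac{p_i+q_i}{2}\right)\ln\left(\frac{p_i+q_i}{2\sqrt{p_iq_i}}\right), & s=1.\end{cases}$$ *)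

(* Defs.v *)
From mathcomp Require Import all_boot all_order all_algebra.
From mathcomp Require Import all_classical all_reals all_analysis.

Set Implicit Arguments.
Unset Strict Implicit.
Unset Printing Implicit Defensive.

Import Order.TTheory GRing.Theory Num.Theory.
Local Open Scope ring_scope.

Definition Gamma (R : realType) (n : nat) : set ('I_n -> R) :=
  [set P | (forall i, 0 < P i) /\ \sum_(i < n) P i = 1]%classic.

(* On Gamma the bases of the real powers below are positive, so that
   [a `^ s] is exp (s * ln a) and the conventions of [powR], [ln] and
   division for nonpositive arguments play no role. *)
Definition divV (R : realType) (n : nat) (s : R) (P Q : 'I_n -> R) : R :=
  if (s == 0) || (s == 1) then
    \sum_(i < n) (P i - Q i) * ln (P i / Q i)
  else
    (s * (s - 1))^-1 *
    (\sum_(i < n) (P i `^ s * Q i `^ (1 - s) + P i `^ (1 - s) * Q i `^ s) - 2).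

Definition divW (R : realType) (n : nat) (s : R) (P Q : 'I_n -> R) : R :=
  if s == 0 then
    2^-1 * (\sum_(i < n) P i * ln (2 * P i / (P i + Q i)) +
            \sum_(i < n) Q i * ln (2 * Q i / (P i + Q i)))
  else if s == 1 then
    \sum_(i < n) (P i + Q i) / 2 *
                 ln ((P i + Q i) / (2 * Num.sqrt (P i * Q i)))
  else
    (s * (s - 1))^-1 *
    (\sum_(i < n) (P i `^ (1 - s) + Q i `^ (1 - s)) / 2 *
                  ((P i + Q i) / 2) `^ s - 1).

(* Main.v *)
Require Import Defs.
From mathcomp Require Import all_boot all_order all_algebra.
From mathcomp Require Import all_classical all_reals all_analysis.
From mathcomp Require Import ring lra.
Import Order.TTheory GRing.Theory Num.Theory.
Local Open Scope ring_scope.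

(** With [m = (p + q) / 2], the generic case rests on the factorization
    [p^s q^(1-s) + p^(1-s) q^s + (p + q) - 2 (p^(1-s) + q^(1-s)) m^s
       = (p^(1-s) + q^(1-s)) (p^s + q^s - 2 m^s)],
    which holds because [p^s p^(1-s) = p]. Since [P] and [Q] both sum to 1,
    the constants in the two divergences turn into sums of [p + q], and
    [V_s - 4 W_s] becomes the sum of these products divided by [s (s - 1)].
    The first factor is positive. The second one is the Jensen gap of [x^s]
    at the midpoint ([powR_midpoint]): [x^s / (s (s - 1))] is convex, so the
    quotient is nonnegative for every [s].

    For [s = 0] and [s = 1] the difference is likewise a sum of multiples of
    Jensen gaps, now of the limiting convex functions [- ln x] and [x ln x].
    Every gap is bounded through a tangent line at [m]: the slopes cancel
    because [(p - m) + (q - m) = 0]. *)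

Lemma expR_convex_comb (R : realType) (a u v : R) : 0 <= a <= 1 ->
  expR (a * u + (1 - a) * v) <= a * expR u + (1 - a) * expR v.
Proof.
case/andP=> a0 a1.
by have := convex_expR (Itv01 a0 a1) u v; rewrite !convRE.
Qed.

(** The graph of the convex function [x^s / (s (s - 1))] lies above its tangent
    at 1. Each range of [s] is one instance of convexity of [expR]: among
    [x^s], [x] and [1], the one whose exponent lies between the other two is
    a weighted geometric mean of these, hence at most their weighted
    arithmetic mean. *)
Lemma powR_tangent1 (R : realType) (s x : R) : s != 0 -> s != 1 -> 0 < x ->
  0 <= (s * (s - 1))^-1 * (x `^ s - 1 - s * (x - 1)).
Proof.
move=> s0 s1 x0.
have -> : x `^ s = expR (s * ln x) by rewrite /powR gt_eqF.
have ex : expR (ln x) = x by rewrite lnK// posrE.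
have [sneg|spos|/eqP] := ltgtP s 0; last by rewrite (negbTE s0).
- have d0 : 0 < 1 - s by lra.
  have a01 : 0 <= (1 - s)^-1 <= 1.
    by rewrite invr_ge0 (ltW d0) /= invf_le1//; lra.
  have := expR_convex_comb _ _ (s * ln x) (ln x) a01.
  have -> : (1 - s)^-1 * (s * ln x) + (1 - (1 - s)^-1) * ln x = 0.
    by field; rewrite gt_eqF.
  rewrite expR0 ex -(ler_pM2l d0).
  have -> : (1 - s) * ((1 - s)^-1 * expR (s * ln x) + (1 - (1 - s)^-1) * x)
      = expR (s * ln x) - s * x by field; rewrite gt_eqF.
  by move=> h; rewrite mulr_ge0 ?invr_ge0//; [nra|lra].
- have [slt|sgt|/eqP] := ltgtP s 1; last by rewrite (negbTE s1).
  + have s01 : 0 <= s <= 1 by rewrite !ltW.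
    have := expR_convex_comb _ _ (ln x) 0 s01.
    rewrite mulr0 addr0 expR0 ex => h.
    by rewrite mulr_le0 ?invr_le0//; [nra|lra].
  + have a01 : 0 <= s^-1 <= 1 by rewrite invr_ge0 (ltW spos) /= invf_le1// ltW.
    have := expR_convex_comb _ _ (s * ln x) 0 a01.
    rewrite mulr0 addr0 mulKf// expR0 ex -(ler_pM2l spos).
    have -> : s * (s^-1 * expR (s * ln x) + (1 - s^-1) * 1)
        = expR (s * ln x) + s - 1 by field.
    by move=> h; rewrite mulr_ge0 ?invr_ge0//; [nra|lra].
Qed.

(** Midpoint convexity of [x^s / (s (s - 1))], by scaling [m] to 1 and adding
    the tangent inequalities at [p / m] and [q / m]. *)
Lemma powR_midpoint (R : realType) (s p q : R) : s != 0 -> s != 1 ->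
  0 < p -> 0 < q ->
  0 <= (s * (s - 1))^-1 * (p `^ s + q `^ s - 2 * ((p + q) / 2) `^ s).
Proof.
move=> s0 s1 p0 q0; set m := (p + q) / 2.
have m0 : 0 < m by rewrite /m; lra.
have rescale r : 0 < r -> r `^ s = m `^ s * (r / m) `^ s.
  move=> r0; rewrite -(powRM s (ltW m0) (ltW (divr_gt0 r0 m0))).
  by rewrite mulrC divfK // gt_eqF.
rewrite (rescale p p0) (rescale q q0).
have pm := powR_tangent1 _ s (p / m) s0 s1 (divr_gt0 p0 m0).
have qm := powR_tangent1 _ s (q / m) s0 s1 (divr_gt0 q0 m0).
have sum2 : q / m = 2 - p / m.
  by rewrite /m; field; rewrite gt_eqF//; lra.
have := mulr_ge0 (powR_ge0 m s) (addr_ge0 pm qm).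
congr (0 <= _); rewrite [in s * (q / m - 1)]sum2; ring.
Qed.

(** Both [- ln] and [x ln x] are controlled by this single inequality:
    dividing by [x] gives the tangent of [ln] at [x], while with the roles of
    [x] and [y] exchanged it is the tangent of [x ln x]. *)
Lemma ln_tangent (R : realType) (x y : R) : 0 < x -> 0 < y ->
  x * (ln y - ln x) <= y - x.
Proof.
move=> x0 y0; rewrite -ln_div ?posrE//.
have yx0 : 0 < y / x by rewrite divr_gt0.
have /le_ln1Dx : -1 < y / x - 1 by lra.
rewrite subrKC -(ler_pM2l x0) => h; apply: le_trans h _.
by rewrite mulrBr mulr1 mulrCA divff ?gt_eqF// mulr1.
Qed.

Lemma ln_midpoint (R : realType) (p q : R) : 0 < p -> 0 < q ->
  ln p + ln q <= 2 * ln ((p + q) / 2).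
Proof.
move=> p0 q0; set m := (p + q) / 2.
have m0 : 0 < m by rewrite /m; lra.
have hp := ln_tangent _ m p m0 p0; have hq := ln_tangent _ m q m0 q0.
have em : p + q = 2 * m by rewrite /m; lra.
by rewrite -(ler_pM2l m0); nra.
Qed.

Lemma xlnx_midpoint (R : realType) (p q : R) : 0 < p -> 0 < q ->
  (p + q) * ln ((p + q) / 2) <= p * ln p + q * ln q.
Proof.
move=> p0 q0; set m := (p + q) / 2.
have m0 : 0 < m by rewrite /m; lra.
have hp := ln_tangent _ p m p0 m0; have hq := ln_tangent _ q m q0 m0.
have em : p + q = 2 * m by rewrite /m; lra.
by nra.
Qed.

Theorem mainTheorem15 (R : realType) (n : nat) (hn : (2 <= n)%N)
    (P Q : 'I_n -> R) (hP : Gamma P) (hQ : Gamma Q) (s : R) :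
  divV s P Q >= 4 * divW s P Q.
Proof.
case: hP hQ => P0 P1 [Q0 Q1].
have m0 i : 0 < (P i + Q i) / 2 by have := P0 i; have := Q0 i; lra.
rewrite /divV /divW; have [_|s0] /= := eqVneq s 0.
  rewrite -big_split /= mulrA mulr_sumr; apply: ler_sum => i _.
  have lnm r : 0 < r -> ln (2 * r / (P i + Q i)) = ln r - ln ((P i + Q i) / 2).
    move=> r0; rewrite -ln_div ?posrE//; congr ln.
    by field; rewrite gt_eqF// addr_gt0.
  rewrite !lnm// (ln_div (P0 i) (Q0 i)).
  have /(ler_wpM2l (ltW (addr_gt0 (P0 i) (Q0 i)))) :=
    ln_midpoint _ _ _ (P0 i) (Q0 i).
  move: (ln (P i)) (ln (Q i)) (ln _) => u v w; lra.
have [_|s1] /= := eqVneq s 1.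
  rewrite mulr_sumr; apply: ler_sum => i _.
  have pq0 : 0 < P i * Q i by rewrite mulr_gt0.
  have -> : ln ((P i + Q i) / (2 * Num.sqrt (P i * Q i)))
      = ln ((P i + Q i) / 2) - 2^-1 * (ln (P i) + ln (Q i)).
    rewrite -lnM ?posrE// -ln_powR powR12_sqrt ?ltW// -ln_div ?posrE ?sqrtr_gt0//.
    by rewrite invfM mulrA.
  rewrite (ln_div (P0 i) (Q0 i)).
  have := xlnx_midpoint _ _ _ (P0 i) (Q0 i).
  move: (ln (P i)) (ln (Q i)) (ln _) => u v w; lra.
rewrite -subr_ge0; set c := (s * (s - 1))^-1.
set A := \sum_(i < n) _; set B := \sum_(i < n) _.
have -> : c * (A - 2) - 4 * (c * (B - 1)) =
    \sum_(i < n) (P i `^ (1 - s) + Q i `^ (1 - s)) *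
      (c * (P i `^ s + Q i `^ s - 2 * ((P i + Q i) / 2) `^ s)).
  have -> : c * (A - 2) - 4 * (c * (B - 1))
      = c * (A - 4 * B + \sum_(i < n) P i + \sum_(i < n) Q i).
    by rewrite P1 Q1; ring.
  rewrite [4 * B]mulr_sumr -sumrB -!big_split mulr_sumr /=.
  apply: eq_bigr => i _.
  have split_pow r : 0 < r -> r = r `^ (1 - s) * r `^ s.
    by move=> r0; rewrite -powRD ?subrK ?powRr1 ?ltW// gt_eqF// implybT.
  (* Once the powers are generalized their bases are hidden, so the
     factorizations rewrite only the summands [P i] and [Q i]. *)
  have := split_pow _ (P0 i); have := split_pow _ (Q0 i).
  move: (_ `^ s) (P i `^ _) (P i `^ _) (Q i `^ _) (Q i `^ _) => M a b a' b'.
  by move=> -> ->; field.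
apply: sumr_ge0 => i _; rewrite mulr_ge0 ?powR_midpoint//.
by rewrite addr_ge0 ?powR_ge0.
Qed.
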